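(* Let $\mathbf S:\mathbb R^N\to\mathbb R^N$ be continuously differentiable with Jacobian $\nabla\mathbf S(\mathbf z)$ and zero set $\mathcal S=\{\mathbf z:\mathbf S(\mathbf z)=\mathbf 0\}$, let $V(\mathbf z)=\tfrac12\|\mathbf S(\mathbf z)\|^2$, and let $\mathcal U\subseteq\mathbb R^N$ be an open set with $\mathcal S\subseteq\mathcal U$. Suppose there exists $m>0$ such that for all $\mathbf z\in\mathcal U$ $$\frac{\nabla\mathbf S(\mathbf z)+\nabla\mathbf S(\mathbf z)^\top}{2}\succeq m I .$$ Let $\sigma(V,t)$ be any of the decay laws (Exp), (FT), (FxT), (PT) listed in the context, and set $\Gamma(V,t)=\sigma(V,t)/(2mV)$. Then for every $\mathbf z\in\mathcal U$ with $V(\mathbf z)\neq0$ and every admissible $t$, the feedback $$\mathbf u(\mathbf z,t)=-\Gamma(V(\mathbf z),t)\,\mathbf S(\mathbf z)$$ for the system $\dot{\mathbf z}=\mathbf u$ satisfies $$\dot V(\mathbf z,t)=\nabla V(\mathbf z)^\top\mathbf u(\mathbf z,t)\le-\sigma(V(\mathbf z),t).$$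
   Context: $\nabla\mathbf S(\mathbf z)$ denotes the Jacobian matrix $\partial\mathbf S/\partial\mathbf z$, so $\nabla V(\mathbf z)=\nabla\mathbf S(\mathbf z)^\top\mathbf S(\mathbf z)$. For $\dot{\mathbf z}=\mathbf u(\mathbf z,t)$ one writes $\dot V(\mathbf z,t)=\nabla V(\mathbf z)^\top\mathbf u(\mathbf z,t)$. $\succeq$ is the Loewner order on symmetric matrices. Decay laws: $\sigma(V,t)$ is one of (Exp) $c\,V$; (FT) $k\,V^{\gamma}$ with $0<\gamma<1$; (FxT) $a\,V^{\gamma}+b\,V^{\delta}$ with $0<\gamma<1<\delta$; (PT) $\frac{\mu}{T-t}V$ for $t\in[0,T)$; where $a,b,c,k,\mu,T$ are positive constants. Admissible times are $t\ge0$ in the first three cases and $t\in[0,T)$ in the (PT) case. *)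

(* Defs.v *)
From HB Require Import structures.
From mathcomp Require Import all_boot all_order all_algebra.
From mathcomp Require Import all_classical all_reals all_analysis.

Set Implicit Arguments.
Unset Strict Implicit.
Unset Printing Implicit Defensive.

Import Order.TTheory GRing.Theory Num.Theory.
Import numFieldNormedType.Exports.

Local Open Scope classical_set_scope.
Local Open Scope ring_scope.

(* Vectors of R^N are row vectors, as required by the library's Jacobian. *)

Definition dotv {R : realType} {N : nat} (x y : 'rV[R]_N) : R :=
  \sum_(i < N) x 0 i * y 0 i.

(* The canonical norm `|x| on matrices is the sup norm, hence this one. *)
Definition enorm {R : realType} {N : nat} (x : 'rV[R]_N) : R :=
  Num.sqrt (\sum_(i < N) x 0 i ^+ 2).

(* 'J S z acts on row vectors (v *m 'J S z = 'd S z v), so that ('J S z) i j is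
   dS_j/dz_i; the usual Jacobian dS_i/dz_j is its transpose. *)
Definition nablaS {R : realType} {N : nat} (S : 'rV[R]_N -> 'rV[R]_N)
  (z : 'rV[R]_N) : 'M[R]_N := ('J S z)^T.

Definition continuously_differentiable {R : realType} {N : nat}
    (S : 'rV[R]_N -> 'rV[R]_N) : Prop :=
  (forall z, differentiable S z) /\ continuous (nablaS S).

Definition gradient {R : realType} {N : nat} (f : 'rV[R]_N -> R)
  (z : 'rV[R]_N) : 'rV[R]_N := \row_(i < N) 'D_(delta_mx 0 i) f z.

Definition symmetric_mx {R : realType} {N : nat} (A : 'M[R]_N) : Prop :=
  A^T = A.

Definition loewner_ge {R : realType} {N : nat} (A B : 'M[R]_N) : Prop :=
  [/\ symmetric_mx A, symmetric_mx B &
      forall x : 'rV[R]_N, 0 <= (x *m (A - B) *m x^T) 0 0].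

Definition lyapunov {R : realType} {N : nat} (S : 'rV[R]_N -> 'rV[R]_N)
  (z : 'rV[R]_N) : R := 2^-1 * enorm (S z) ^+ 2.

Definition Vdot {R : realType} {N : nat} (V : 'rV[R]_N -> R)
  (u : 'rV[R]_N -> R -> 'rV[R]_N) (z : 'rV[R]_N) (t : R) : R :=
  dotv (gradient V z) (u z t).

Variant decay_law (R : realType) : Type :=
| Exp (c : R)
| FT (k gamma : R)
| FxT (a b gamma delta : R)
| PT (mu T : R).

Definition decay_law_wf {R : realType} (l : decay_law R) : Prop :=
  match l with
  | Exp c => 0 < c
  | FT k gamma => [/\ 0 < k, 0 < gamma & gamma < 1]
  | FxT a b gamma delta =>
      [/\ 0 < a, 0 < b, 0 < gamma, gamma < 1 & 1 < delta]
  | PT mu T => 0 < mu /\ 0 < T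
  end.

Definition sigma {R : realType} (l : decay_law R) (V t : R) : R :=
  match l with
  | Exp c => c * V
  | FT k gamma => k * V `^ gamma
  | FxT a b gamma delta => a * V `^ gamma + b * V `^ delta
  | PT mu T => mu / (T - t) * V
  end.

Definition admissible {R : realType} (l : decay_law R) (t : R) : Prop :=
  match l with
  | PT _ T => 0 <= t /\ t < T
  | _ => 0 <= t
  end.

Definition Gamma {R : realType} (m : R) (l : decay_law R) (V t : R) : R :=
  sigma l V t / (2 * m * V).

Definition feedback {R : realType} {N : nat} (S : 'rV[R]_N -> 'rV[R]_N)
  (m : R) (l : decay_law R) (z : 'rV[R]_N) (t : R) : 'rV[R]_N :=
  - (Gamma m l (lyapunov S z) t *: S z).

(* Main.v *)
Require Import Defs.
From HB Require Import structures.
From mathcomp Require Import all_boot all_order all_algebra.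
From mathcomp Require Import all_classical all_reals all_analysis.
From mathcomp Require Import ring lra.

Import Order.TTheory GRing.Theory Num.Theory.
Import numFieldNormedType.Exports.

Local Open Scope classical_set_scope.
Local Open Scope ring_scope.

(** Writing [s = S z], the chain rule gives [grad V = s *m nablaS S z], so that
    [Vdot = - Gamma * (s (nablaS S z) s^T)].  A quadratic form only sees the
    symmetric part of its matrix, hence [s (nablaS S z) s^T >= m |s|^2 = 2 m V];
    as [Gamma >= 0], [Vdot <= - Gamma * 2 m V = - sigma]. *)

Lemma dotvE (R : realType) (N : nat) (x y : 'rV[R]_N) :
  dotv x y = (x *m y^T) 0 0.
Proof. by rewrite mxE; apply: eq_bigr => i _; rewrite mxE. Qed.

Lemma enorm_sqr (R : realType) (N : nat) (x : 'rV[R]_N) :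
  enorm x ^+ 2 = dotv x x.
Proof.
rewrite /enorm sqr_sqrtr; last by apply: sumr_ge0 => i _; exact: sqr_ge0.
by apply: eq_bigr => i _; rewrite expr2.
Qed.

Lemma lyapunov_ge0 (R : realType) (N : nat) (S : 'rV[R]_N -> 'rV[R]_N) z :
  0 <= lyapunov S z.
Proof. by rewrite /lyapunov mulr_ge0 ?invr_ge0 ?sqr_ge0. Qed.

(** In coordinates, the [i]-th partial derivative of half the sum of the [S_j ^+ 2] is the sum over
    [j] of [S_j] times [dS_j/dz_i]. This is the row-vector form of the Jacobian transpose applied to
    [S z]. *)
Lemma gradient_lyapunov (R : realType) (N : nat) (S : 'rV[R]_N -> 'rV[R]_N)
    (z : 'rV[R]_N) : differentiable S z ->
  gradient (lyapunov S) z = S z *m nablaS S z.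
Proof.
move=> dS; apply/rowP => i; rewrite !mxE.
(* Row [i] of ['J S z] is the derivative of [S] along the [i]-th basis vector, and that derivative
   is taken coordinatewise. *)
have dSj (j : 'I_N) : is_derive z (delta_mx 0 i) (fun w => S w 0 j) ('J S z i j).
  have dSi : derivable S z (delta_mx 0 i) by exact: diff_derivable.
  split; first by move/derivable_mxP : dSi; exact.
  have := deriveEjacobian (delta_mx 0 i) dS.
  by rewrite derive_mx // -rowE => /rowP/(_ j); rewrite !mxE.
have dV := @is_deriveZ _ _ _ _ 2^-1 _ _ _
  (is_derive_sum (fun j => is_deriveX 2 (dSj j))).
(* Written as a combination of functions rather than of values, [lyapunov S] has the shape that [dV]
   differentiates. *)
have -> : lyapunov S = 2^-1 \*: (\sum_(j < N) (fun w => S w 0 j) ^+ 2).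
  apply/funext => w; rewrite /lyapunov enorm_sqr /= fct_sumE.
  by congr (_ * _); apply: eq_bigr => j _; rewrite fctE expr2.
rewrite (@derive_val _ _ _ _ _ _ _ dV) scaler_sumr; apply: eq_bigr => j _.
by rewrite !mxE expr1 /GRing.scale /=; field.
Qed.

Lemma loewner_sym_part (R : realType) (N : nat) (A : 'M[R]_N) (m : R)
    (x : 'rV[R]_N) :
  loewner_ge (2^-1 *: (A + A^T)) (m *: 1%:M) ->
  m * dotv x x <= (x *m A *m x^T) 0 0.
Proof.
case=> _ _ /(_ x).
(* The two forms are transposes of each other, and a 1 by 1 matrix equals its transpose. *)
have trA : (x *m A^T *m x^T) 0 0 = (x *m A *m x^T) 0 0.
  have -> : x *m A^T *m x^T = (x *m A *m x^T)^T.
    by rewrite !trmx_mul trmxK mulmxA.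
  by rewrite [LHS]mxE.
rewrite mulmxBr mulmxBl -!scalemxAr -!scalemxAl mulmx1 mulmxDr mulmxDl dotvE.
(* Abstracting the products keeps [mxE] from expanding them into sums, so that [lra] sees three
   scalars. *)
move: (x *m A *m x^T) (x *m A^T *m x^T) (x *m x^T) trA => q q' p qE.
rewrite !mxE qE.
lra.
Qed.

Lemma sigma_ge0 (R : realType) (l : decay_law R) (V t : R) :
  decay_law_wf l -> admissible l t -> 0 <= V -> 0 <= sigma l V t.
Proof.
case: l => [c|k g|a b g d|mu T] /=.
- by move=> c0 _ V0; rewrite mulr_ge0 // ltW.
- by case=> k0 _ _ _ _; rewrite mulr_ge0 ?powR_ge0 ?(ltW k0).
- by case=> a0 b0 _ _ _ _ _;
  rewrite addr_ge0 ?mulr_ge0 ?powR_ge0 ?(ltW a0) ?(ltW b0).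
- by case=> mu0 _ [_ tT] V0;
  rewrite mulr_ge0 ?divr_ge0 ?subr_ge0 ?(ltW mu0) ?(ltW tT).
Qed.

Theorem mainTheorem3 (R : realType) (N : nat)
    (S : 'rV[R]_N -> 'rV[R]_N) (U : set 'rV[R]_N) (m : R) (l : decay_law R)
    (S_C1 : continuously_differentiable S)
    (U_open : open U)
    (zeros_sub_U : [set z | S z = 0] `<=` U)
    (m_gt0 : 0 < m)
    (S_mono : forall z, U z ->
       loewner_ge (2^-1 *: (nablaS S z + (nablaS S z)^T)) (m *: 1%:M))
    (l_wf : decay_law_wf l) :
  forall (z : 'rV[R]_N) (t : R),
    U z -> lyapunov S z <> 0 -> admissible l t ->
    Vdot (lyapunov S) (feedback S m l) z t <= - sigma l (lyapunov S z) t.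
Proof.
move=> z t Uz /eqP V_neq0 t_adm.
have V_ge0 := lyapunov_ge0 _ _ S z.
have Gamma_ge0 : 0 <= Gamma m l (lyapunov S z) t.
  apply: divr_ge0; first exact: sigma_ge0.
  exact: mulr_ge0 (mulr_ge0 (ler0n _ 2) (ltW m_gt0)) V_ge0.
(* The assumption that [V] does not vanish enters here: it lets the denominator [2 * m * V] of
   [Gamma] cancel. *)
have sigmaE : sigma l (lyapunov S z) t
    = Gamma m l (lyapunov S z) t * (m * dotv (S z) (S z)).
  have -> : m * dotv (S z) (S z) = 2 * m * lyapunov S z.
    by rewrite /lyapunov enorm_sqr; field.
  rewrite /Gamma divfK //; apply: mulf_neq0 => //.
  by rewrite mulf_neq0 ?pnatr_eq0 ?gt_eqF.
rewrite /Vdot gradient_lyapunov; last exact: S_C1.1.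
rewrite dotvE /feedback linearN linearZ /= mulmxN -scalemxAr.
rewrite [leLHS]mxE [X in - X <= _]mxE.
(* Both sides are now minus [Gamma] times a quadratic form in [S z], so it suffices to compare the
   forms. *)
rewrite sigmaE lerN2 ler_wpM2l //.
exact: loewner_sym_part (S_mono z Uz).
Qed.
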